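(* Let $E$ be a linear Polish space and let $\mu$ be a probability measure on its Borel $\sigma$-algebra. Let $\mathcal{U}\subseteq E$ be a normed (linear) subspace with norm $|\cdot|_{\mathcal{U}}$, and let $d_{\mathcal{U}}\colon E\times E\to[0,\infty]$ be defined by $d_{\mathcal{U}}(x,y)=|x-y|_{\mathcal{U}}$ if $x-y\in\mathcal{U}$ and $d_{\mathcal{U}}(x,y)=+\infty$ otherwise. Assume that there are $p\in[1,\infty)$ and a constant $C$ such that for every Borel probability measure $\nu$ on $E$, $$\inf_{\pi\in\Pi(\nu,\mu)}\left(\int_{E\times E}d_{\mathcal{U}}(x,y)^p\,d\pi(x,y)\right)^{\frac1p}\le\sqrt{C\,H(\nu\,|\,\mu)}.$$ Let $(F,d)$ be a metric space and let $f\colon E\to F$ be Borel measurable. Choose $r_0\ge0$ and $e\in F$ such that $$\mu\{x\in E: d(f(x),e)\le r_0\}=:a>0.$$ Assume that there are measurable functions $g,\sigma\colon E\to[0,\infty]$ such that $$d(f(x+h),e)\le g(x)+\sigma(x)|h|_{\mathcal{U}}$$ for every $x\in E$ and every $h\in\mathcal{U}$, and assume that $g\in L^1(\mu)$ and $\sigma\in L^q(\mu)$, where $q\in(1,\infty]$ is such that $\frac1p+\frac1q=1$. Then $$\mu\{x\in E: d(f(x),e)>r\}\le\exp\left\{-\frac{(r-r_1)^2}{C\,\|\sigma\|_{L^q(\mu)}^2}\right\}$$ for all $r\ge r_1$, where $r_1=r_0+4\|g\|_{L^1(\mu)}+\|\sigma\|_{L^q(\mu)}\sqrt{2C\log(a^{-1})}$.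 In particular, the random variable $d(f(\cdot),e)\colon E\to[0,\infty)$ has Gaussian tails.
   Context: $\Pi(\nu,\mu)$ is the set of probability measures on the product space with marginals $\nu$ and $\mu$. The relative entropy is $H(\nu\,|\,\mu)=\int\log\left(\frac{d\nu}{d\mu}\right)d\nu$ if $\nu\ll\mu$ and $+\infty$ otherwise. A nonnegative random variable $Z$ has Gaussian tails if there are constants $K,\eta>0$ with $\mathbb{P}(Z>r)\le Ke^{-\eta r^2}$ for all $r\ge0$. *)

(* Defs.v *)
From HB Require Import structures.
From mathcomp Require Import all_boot all_order all_algebra.
From mathcomp Require Import all_classical all_reals all_analysis.
From mathcomp Require Import measurable_realfun.

Set Implicit Arguments.
Unset Strict Implicit.
Unset Printing Implicit Defensive.

Import Order.TTheory GRing.Theory Num.Theory.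
Import numFieldNormedType.Exports.

Local Open Scope classical_set_scope.
Local Open Scope ring_scope.

(* A measurableType must be pointed, which a topologicalZmodType is not. *)
Definition pointed_at0 (E : topologicalZmodType) : Type := E.
HB.instance Definition _ (E : topologicalZmodType) :=
  Choice.copy (pointed_at0 E) E.
HB.instance Definition _ (E : topologicalZmodType) :=
  isPointed.Build (pointed_at0 E) (0 : E).

Notation borel E := (g_sigma_algebraType (@open E : set (set (pointed_at0 E)))).

(* Stated without the library's measurable_fun because the codomain, an
   arbitrary topological space, is not pointed. *)
Definition borel_measurable (E : topologicalZmodType) (T : topologicalType)
    (f : E -> T) : Prop :=
  forall B : set T, <<s @open T >> B -> measurable (f @^-1` B : set (borel E)).

(* Nonnegativity of d follows from the other axioms of a metric. *)
Definition completely_metrizable (R : realType) (T : topologicalType) : Prop :=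
  exists d : T -> T -> R,
    [/\ [/\ forall x y, d x y = 0 <-> x = y,
            forall x y, d x y = d y x
          & forall x y z, d x z <= d x y + d y z],
        forall (x : T) (A : set T),
          nbhs x A <-> exists2 r, 0 < r & [set y | d x y < r] `<=` A
      & forall u : nat -> T,
          (forall eps, 0 < eps -> exists N : nat, forall m n : nat,
             (N <= m)%N -> (N <= n)%N -> d (u m) (u n) < eps) ->
          exists l : T, u @ \oo --> l].

Definition polish (R : realType) (T : topologicalType) : Prop :=
  (exists2 D : set T, countable D & dense D) /\ completely_metrizable R T.

(* A norm on the linear subspace U, as a function on the ambient space: its
   values outside U are irrelevant. *)
Definition norm_on (R : realType) (E : lmodType R) (U : submodClosed E)
    (N : E -> R) : Prop :=
  [/\ {in U, forall x, 0 <= N x},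
      {in U, forall x, N x = 0 -> x = 0},
      {in U &, forall x y, N (x + y) <= N x + N y}
    & forall a, {in U, forall x, N (a *: x) = `|a| * N x}].

Definition subspace_dist (R : realType) (E : lmodType R) (U : submodClosed E)
    (N : E -> R) (x y : E) : \bar R :=
  if x - y \in U then (N (x - y))%:E else +oo%E.

Definition couplings (R : realType) (d1 d2 : measure_display)
    (T1 : measurableType d1) (T2 : measurableType d2)
    (nu : probability T1 R) (mu : probability T2 R) :
    set (probability (T1 * T2)%type R) :=
  [set pi | (forall A, measurable A -> pi (A `*` [set: T2]) = nu A) /\
            (forall B, measurable B -> pi ([set: T1] `*` B) = mu B)].

Section relative_entropy.
Local Open Scope ereal_scope.
Local Open Scope charge_scope.

Definition relative_entropy (R : realType) (d : measure_display)
    (T : measurableType d) (nu mu : probability T R) : \bar R :=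
  if `[< nu `<< mu >] then
    \int[nu]_x lne (('d (charge_of_finite_measure nu) '/d mu) x)
  else +oo.

End relative_entropy.

(* The integrand need not be measurable; the integral of a nonnegative function
   is the supremum of the integrals of the measurable simple functions below
   it. *)
Definition transport_cost (R : realType) (E : topologicalLmodType R)
    (U : submodClosed E) (N : E -> R) (p : R)
    (nu mu : probability (borel E) R) : \bar R :=
  ereal_inf
    [set ((\int[pi]_z (subspace_dist U N z.1 z.2 `^ p)) `^ p^-1)%E
      | pi in couplings nu mu].

Definition gaussian_tails (R : realType) (d : measure_display)
    (T : measurableType d) (P : probability T R) (Z : T -> R) : Prop :=
  [/\ measurable_fun [set: T] Z,
      forall x, 0 <= Z x
    & exists K eta : R, [/\ 0 < K, 0 < eta &
        forall r, 0 <= r ->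
          (P [set x | (r < Z x)%R] <= (K * expR (- eta * r ^+ 2))%:E)%E]].

(* Main.v *)
Require Import Defs.
From HB Require Import structures.
From mathcomp Require Import all_boot all_order all_algebra.
From mathcomp Require Import all_classical all_reals all_analysis.
From mathcomp Require Import measurable_realfun ess_sup_inf.
From mathcomp Require Import ring lra.

Set Implicit Arguments.
Unset Strict Implicit.
Unset Printing Implicit Defensive.

Import Order.TTheory GRing.Theory Num.Theory.
Import numFieldNormedType.Exports.

Local Open Scope classical_set_scope.
Local Open Scope ring_scope.

(* Fix r, put A = {d(f, e) > r} and let nu be mu conditioned on A, so that
   H(nu | mu) = - ln (mu A).  For a coupling pi of nu and mu, the growth
   condition bounds r by g(y) + sigma(y) d_U(x, y) for pi-almost every (x, y);
   integrating and using Hoelder's inequality under the second marginal mu gives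
   r <= |g|_1 + |sigma|_q sqrt (C (- ln (mu A))), which is the tail bound with
   |g|_1 <= r_1 in place of r_1.
   As d_U need not be measurable, it is replaced on A x E by its measurable
   minorant psi(y) = max(0, r - g(y)) / (sigma(y) + eps), where eps, which
   avoids a division by 0, tends to 0 at the end. *)

Local Open Scope ereal_scope.

(** * Powers, lower integrals, Hoelder's inequality and couplings *)

Lemma le_poweR2r (R : realType) (r : R) (x y : \bar R) :
  (0 <= r)%R -> 0 <= x -> x <= y -> x `^ r <= y `^ r.
Proof.
move=> r0 x0 xy; apply: gt0_ler_poweR; rewrite // in_itv/= leey andbT//.
exact: le_trans xy.
Qed.

(* Unlike [ge0_le_integral], no measurability of the majorant is required. *)
Lemma le_lower_integral d (T : measurableType d) (R : realType)
    (mu : {measure set T -> \bar R}) (f1 f2 : T -> \bar R) :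
  (forall x, 0 <= f1 x) -> (forall x, f1 x <= f2 x) ->
  \int[mu]_x f1 x <= \int[mu]_x f2 x.
Proof.
move=> f10 f12; have f20 x : 0 <= f2 x by exact: le_trans (f12 x).
rewrite !ge0_integralTE//; apply: ereal_sup_le; apply: image_subset => h hf1 x.
exact: le_trans (f12 x).
Qed.

(** At [q = +oo] the conjugacy relation forces [p = 1]. There [|g|] is almost everywhere at most its
    essential supremum, which is pulled out of the integral of [|f g|]. *)
Lemma hoelder_ge1 d (T : measurableType d) (R : realType)
    (mu : {measure set T -> \bar R}) (f g : T -> R) (p : R) (q : \bar R) :
  measurable_fun [set: T] f -> measurable_fun [set: T] g ->
  0 < mu [set: T] -> (1 <= p)%R -> 1 < q -> p%:E^-1 + q^-1 = 1 ->
  'N[mu]_1[EFin \o (f \* g)%R]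
    <= 'N[mu]_p%:E[EFin \o f] * 'N[mu]_q[EFin \o g].
Proof.
move=> mf mg muT p1 q1 pq.
have p0 : (0 < p)%R by exact: lt_le_trans p1.
case: q q1 pq => [q q1|_|//].
  have q0 : (0 < q)%R by rewrite -lte_fin; exact: lt_trans q1.
  by rewrite !inver !gt_eqF// => -[pq]; exact: hoelder.
rewrite invey adde0 => /eqP; rewrite inve_eq1 => /eqP ->.
rewrite !Lnorm1.
have mNf : measurable_fun [set: T] (fun x => `|(EFin \o f) x|).
  by apply: measurableT_comp => //; exact/measurable_EFinP.
have -> : 'N[mu]_+oo[EFin \o g] = ess_sup mu (abse \o (EFin \o g)).
  by rewrite unlock muT.
set M := ess_sup _ _.
have M0 : 0 <= M.
  by apply: ess_sup_gee => //; apply: nearW => x; exact: abse_ge0.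
rewrite -ge0_integralZr//.
apply: ae_ge0_le_integral => //.
- by do 2 apply: measurableT_comp => //; exact: measurable_funM.
- by move=> x _; rewrite mule_ge0.
- exact: emeasurable_funM.
apply: filterS (ess_sup_ge mu (abse \o (EFin \o g))) => x gM _ /=.
by rewrite normrM EFinM lee_wpmul2l.
Qed.

(* The cost [c] need not be measurable; since [psi] only depends on the second
   variable, its norm is computed under the second marginal. *)
Lemma le_Lnorm_coupling d1 d2 (T1 : measurableType d1) (T2 : measurableType d2)
    (R : realType) (nu : probability T1 R) (mu : probability T2 R)
    (pi : probability (T1 * T2)%type R) (A : set T1) (psi : T2 -> R)
    (c : T1 * T2 -> \bar R) (p : R) :
  couplings nu mu pi -> measurable A -> nu A = 1 ->
  measurable_fun [set: T2] psi -> (forall y, 0 <= psi y)%R ->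
  (forall z, 0 <= c z) -> (forall x y, A x -> (psi y)%:E <= c (x, y)) ->
  (0 < p)%R ->
  'N[mu]_p%:E[EFin \o psi] <= (\int[pi]_z (c z `^ p)) `^ p^-1.
Proof.
move=> [pi1 pi2] mA nuA mpsi psi0 c0 psic p0.
rewrite unlock; apply: le_poweR2r; first by rewrite invr_ge0 ltW.
  by apply: integral_ge0 => y _; rewrite poweR_ge0.
have mpsip : measurable_fun [set: T2] (fun y => (psi y `^ p)%:E).
  apply/measurable_EFinP.
  exact: (@measurableT_comp _ _ _ _ _ _ (@powR R ^~ p)).
have psip0 y : 0 <= (psi y `^ p)%:E by rewrite lee_fin powR_ge0.
have m2 : measurable_fun [set: T1 * T2] (fun z => (psi z.2 `^ p)%:E).
  exact: (measurableT_comp mpsip measurable_snd).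
under eq_integral do rewrite /= ger0_norm//.
have -> : \int[mu]_y (psi y `^ p)%:E
    = \int[pushforward pi snd]_y (psi y `^ p)%:E.
  apply: eq_measure_integral => B mB _.
  by transitivity (pi ([set: T1] `*` B)); [exact/esym/pi2|rewrite setTX].
rewrite (ge0_integral_pushforward measurable_snd)//= preimage_setT.
have mAT : measurable (A `*` [set: T2]) by exact: measurableX.
have ATae : {ae pi, forall z, A z.1}.
  exists (~` (A `*` [set: T2])); split; first exact: measurableC.
    by rewrite probability_setC// pi1// nuA subee.
  by move=> z /= Az [].
have mind : measurable_fun [set: T1 * T2]
    (fun z => (\1_(A `*` [set: T2]) z * psi z.2 `^ p)%:E).
  apply/measurable_EFinP; apply: measurable_funM; first exact: measurable_indic.
  exact/measurable_EFinP.
(* The comparison of lower integrals is pointwise everywhere, while [psi] is below [c] only over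
   [A]. The indicator makes the integrand vanish elsewhere and changes it only on a [pi]-null
   set. *)
rewrite (ae_eq_integral
  (fun z => (\1_(A `*` [set: T2]) z * psi z.2 `^ p)%:E))//.
  apply: le_lower_integral => [z|[x y]/=].
    by rewrite lee_fin mulr_ge0// powR_ge0.
  rewrite indicE; case: (boolP (_ \in _)) => [|_]; last by rewrite mul0r poweR_ge0.
  rewrite inE => -[/= Ax _]; rewrite mul1r -poweR_EFin.
  by apply: le_poweR2r; [exact: ltW | rewrite lee_fin | exact: psic].
by apply: filterS ATae => z Az _; rewrite indicE mem_set// mul1r.
Qed.

(** * Conditioning on an event and its relative entropy *)

Lemma mnormalize_mrestrE d (T : measurableType d) (R : realType)
    (mu : probability T R) (A : set T) (mA : measurable A) (B : set T) :
  0 < mu A ->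
  mnormalize (mrestr mu mA) mu B = mu (B `&` A) * (fine (mu A))^-1%:E.
Proof.
move=> muA0; rewrite /mnormalize /= /mrestr setTI gt_eqF//=.
have muAfin : mu A \is a fin_num by exact: fin_num_measure.
by case: ifPn => // /eqP muAy; rewrite muAy in muAfin.
Qed.

(** The conditioned measure has density [\1_A / mu A] with respect to [mu] and is carried by [A],
    where the logarithm of this density is constant. *)
Lemma relative_entropy_conditioning d (T : measurableType d) (R : realType)
    (mu : probability T R) (A : set T) (mA : measurable A) : 0 < mu A ->
  relative_entropy (mnormalize (mrestr mu mA) mu) mu = (- ln (fine (mu A)))%:E.
Proof.
move=> muA0.
set nu := mnormalize _ _.
set a := fine (mu A).
have muAfin : mu A \is a fin_num by exact: fin_num_measure.
have a0 : (0 < a)%R by apply: fine_gt0; rewrite muA0 ltey_eq muAfin.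
have nuE B : nu B = mu (B `&` A) * (a^-1)%:E by exact: mnormalize_mrestrE.
have numu : nu `<< mu.
  apply/null_content_dominatesP => B mB muB0; rewrite nuE.
  rewrite (_ : mu (B `&` A) = 0) ?mul0e//; apply/eqP.
  rewrite eq_le measure_ge0 andbT -[leRHS]muB0 le_measure// ?inE//.
  exact: measurableI.
rewrite /relative_entropy asboolT//.
set D := Radon_Nikodym _ _.
have Dint : mu.-integrable [set: T] D by exact: Radon_Nikodym_integrable.
have Dfin x : D x \is a fin_num by exact: Radon_Nikodym_fin_num.
have DE : ae_eq mu [set: T] D (fun x => (a^-1 * \1_A x)%:E).
  have mind : measurable_fun [set: T] (fun x => (\1_A x : R)%:E).
    exact/measurable_EFinP/measurable_indic.
  apply: integral_ae_eq => //.
    by apply/measurable_EFinP/measurable_funM => //; exact: measurable_indic.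
  move=> B _ mB; rewrite -Radon_Nikodym_integral//=.
  under eq_integral do rewrite EFinM.
  rewrite ge0_integralZl//; last 2 first.
  - exact: measurable_funTS.
  - by rewrite lee_fin invr_ge0 ltW.
  by rewrite integral_indic// muleC setIC.
have Aae : {ae nu, forall x, A x}.
  exists (~` A); split => //; first exact: measurableC.
  by rewrite nuE setICl measure0 mul0e.
have lneD : ae_eq nu [set: T] (fun x => lne (D x)) (cst (- ln a)%:E).
  have := null_dominates_ae_eq measurableT numu DE.
  apply: filterS2 Aae => x Ax /(_ I) /= -> _; rewrite indicE mem_set// mulr1.
  by rewrite lne_EFin ?invr_gt0// lnV// posrE.
rewrite (ae_eq_integral (cst (- ln a)%:E))//; last first.
  (* As [D] is finite everywhere, measurability of [lne \o D] reduces to that of the real logarithm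
     and of a sign test. *)
  have -> : (fun x => lne (D x))
      = (fun x => if (fine (D x) <= 0)%R then -oo else (ln (fine (D x)))%:E).
    by apply/funext => x; rewrite -{1}(fineK (Dfin x)).
  have mD : measurable_fun [set: T] (fine \o D).
    apply: measurableT_comp; first exact: fine_measurable.
    exact: measurable_int Dint.
  apply: measurable_fun_ifT => //; first exact: measurable_fun_ler.
  by apply/measurable_EFinP; exact: measurableT_comp.
by rewrite integral_cst// [X in _ * X]probability_setT mule1.
Qed.

(** * Norms in L^q and the bound given by one coupling *)

Lemma le_Lnorm d (T : measurableType d) (R : realType)
    (mu : {measure set T -> \bar R}) (q : \bar R) (f g : T -> \bar R) :
  0 < q -> (forall x, `|f x| <= `|g x|) -> 'N[mu]_q[f] <= 'N[mu]_q[g].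
Proof.
rewrite unlock; case: q => [q| |]// q0 fg; last first.
  by case: ifPn => // _; apply: le_ess_sup; exact: nearW.
apply: le_poweR2r; first by rewrite invr_ge0 ltW.
  by apply: integral_ge0 => x _; rewrite poweR_ge0.
apply: le_lower_integral => x; first by rewrite poweR_ge0.
by apply: le_poweR2r => //; exact: ltW.
Qed.

Lemma Lnorm_cst d (T : measurableType d) (R : realType)
    (mu : {measure set T -> \bar R}) (q : \bar R) (x : R) :
  mu [set: T] = 1 -> 0 < q -> 'N[mu]_q[cst x%:E] = `|x%:E|.
Proof.
move=> muT; rewrite unlock; case: q => [q| |]// q0; last first.
  rewrite muT lte01 [X in ess_sup _ X](_ : _ = cst `|x%:E|)//.
  by rewrite ess_sup_cst// muT.
rewrite /= integral_cst// muT mule1 poweR_EFin -powRrM mulfV ?powRr1//.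
by rewrite gt_eqF.
Qed.

Lemma Lnorm_lty_ae d (T : measurableType d) (R : realType)
    (mu : {measure set T -> \bar R}) (q : \bar R) (f : T -> \bar R) :
  measurable_fun [set: T] f -> 0 < mu [set: T] -> 0 < q ->
  'N[mu]_q[f] < +oo -> {ae mu, forall x, `|f x| < +oo}.
Proof.
move=> mf muT; case: q => [q| |]// q0.
  move=> fq; have : mu.-integrable [set: T] (fun x => `|f x| `^ q).
    apply/integrableP; split.
      apply: (measurableT_comp (measurable_poweR q)).
      exact: measurableT_comp.
    under eq_integral do rewrite gee0_abs ?poweR_ge0//.
    by rewrite -poweR_Lnorm ?poweR_lty// gt_eqF.
  move=> /integrable_ae-/(_ measurableT); apply: filterS => x /(_ I).
  rewrite ge0_fin_numE ?poweR_ge0//; apply: lty_poweRy.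
  by rewrite gt_eqF.
rewrite unlock muT => fy.
by apply: filterS (ess_sup_ge mu (abse \o f)) => x fx; exact: le_lt_trans fy.
Qed.

(** Here [c] stands for d_U. Solving the growth condition for [c] gives the minorant [psi], which is
    large enough that [g + (sigma + eps) psi] still dominates [r] almost everywhere under [mu]. *)
Lemma coupling_bound d (T : measurableType d) (R : realType)
    (nu mu : probability T R) (pi : probability (T * T)%type R) (A : set T)
    (c : T * T -> \bar R) (g sigma : T -> \bar R) (p : R) (q : \bar R)
    (r eps : R) :
  couplings nu mu pi -> measurable A -> nu A = 1 ->
  (forall z, 0 <= c z) -> (forall x, 0 <= g x) -> (forall x, 0 <= sigma x) ->
  measurable_fun [set: T] g -> measurable_fun [set: T] sigma ->
  (1 <= p)%R -> 1 < q -> p%:E^-1 + q^-1 = 1 -> 'N[mu]_q[sigma] < +oo ->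
  (forall x y, A x -> c (x, y) < +oo -> r%:E <= g y + sigma y * c (x, y)) ->
  (0 < eps)%R ->
  r%:E <= 'N[mu]_1[g]
    + ('N[mu]_q[sigma] + eps%:E) * (\int[pi]_z (c z `^ p)) `^ p^-1.
Proof.
move=> pinumu mA nuA c0 g0 sigma0 mg msigma p1 q1 pq sigmaq rg eps0.
have p0 : (0 < p)%R by exact: lt_le_trans p1.
have q0 : 0 < q by exact: lt_trans q1.
have muT : (mu : {measure set T -> \bar R}) [set: T] = 1.
  exact: probability_setT.
pose s y := (fine (sigma y) + eps)%R.
(* Since [fine] sends [+oo] to 0, the quotient in [psi] need not be a minorant of [c] where [g] or
   [sigma] is infinite; [psi] is set to 0 there. *)
pose D := [set y | g y < +oo] `&` [set y | sigma y < +oo].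
pose psi y := (\1_D y * (Num.max 0 (r - fine (g y)) / s y))%R.
have s_gt0 y : (0 < s y)%R by rewrite ltr_wpDl ?fine_ge0.
have psi0 y : (0 <= psi y)%R.
  by rewrite mulr_ge0// divr_ge0 ?le_max ?lexx// ltW.
have mfine h : measurable_fun [set: T] h ->
    measurable_fun [set: T] (fun x => fine (h x) : R).
  by apply: measurableT_comp; exact: fine_measurable.
have ms : measurable_fun [set: T] s.
  by apply: measurable_funD => //; exact: mfine.
have mD : measurable D.
  apply: measurableI; rewrite -[X in measurable X]setTI.
  - exact: emeasurable_fun_infty_o.
  - exact: emeasurable_fun_infty_o.
have mpsi : measurable_fun [set: T] psi.
  apply: measurable_funM; first exact: measurable_indic.
  apply: measurable_funM.
    by apply: measurable_maxr => //; apply: measurable_funB => //; exact: mfine.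
  rewrite (_ : (fun y => _) = (fun y => s y `^ -1)%R).
    exact: (@measurableT_comp _ _ _ _ _ _ (@powR R ^~ (- 1)%R)).
  by apply/funext => y; rewrite powR_inv1 ?ltW.
have psic x y : A x -> (psi y)%:E <= c (x, y).
  move=> Ax; have [cy|cy] := ltP (c (x, y)) +oo; last first.
    by move: cy; rewrite leye_eq => /eqP ->; rewrite leey.
  have := rg _ _ Ax cy; have := c0 (x, y); rewrite /psi /s indicE.
  case: (boolP (_ \in _)) => [|_]; last by rewrite mul0r.
  rewrite inE => -[/= gy sy] + {}rg.
  move: (g0 y) (sigma0 y) cy gy sy rg.
  case: (g y) (sigma y) (c (x, y)) => [gy| |]// [sy| |]// [n| |]//=.
  rewrite !lee_fin mul1r => gy0 sy0 _ _ _ rg n0.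
  rewrite ler_pdivrMr ?ltr_wpDl// ge_max mulr_ge0 ?addr_ge0 ?(ltW eps0)//=.
  rewrite lerBlDl (le_trans rg)// lerD2l mulrC ler_wpM2l// lerDl ltW//.
(* A finite norm makes [sigma] finite almost everywhere; where [g] is infinite the right-hand side
   is [+oo]. *)
have r_le : {ae mu, forall y, r%:E <= g y + (s y * psi y)%:E}.
  have := Lnorm_lty_ae msigma _ q0 sigmaq; rewrite muT lte01 => /(_ isT).
  apply: filterS => y sy.
  have [gy|gy] := ltP (g y) +oo; last first.
    by move: gy; rewrite leye_eq => /eqP ->; rewrite addye ?leey.
  have Dy : D y by split => //=; rewrite -(gee0_abs (sigma0 y)).
  rewrite /psi indicE mem_set// mul1r.
  rewrite mulrC divfK ?gt_eqF// -{1}(@fineK _ (g y)) ?ge0_fin_numE//.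
  by rewrite lee_fin -lerBlDl le_max lexx orbT.
have : r%:E <= 'N[mu]_1[g] + 'N[mu]_1[EFin \o (s \* psi)%R].
  rewrite !Lnorm1.
  under [X in X + _]eq_integral do rewrite gee0_abs//.
  have spsi0 y : 0 <= (s y * psi y)%:E by rewrite lee_fin mulr_ge0// ltW.
  have -> : \int[mu]_y `|(EFin \o (s \* psi)%R) y|
      = \int[mu]_y (s y * psi y)%:E.
    by apply: eq_integral => y _; exact/gee0_abs/spsi0.
  have mspsi : measurable_fun [set: T] (fun y => (s y * psi y)%:E).
    exact/measurable_EFinP/measurable_funM.
  rewrite -ge0_integralD//.
  (* The integrals compared below are of nonnegative functions, so [r <= 0] is treated apart. *)
  have [r0|r0] := leP r 0%R.
    rewrite (@le_trans _ _ 0)// ?lee_fin// integral_ge0// => y _.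
    by rewrite adde_ge0.
  rewrite -[leLHS]mule1 -(probability_setT mu) -integral_cst//.
  apply: ae_ge0_le_integral => //.
  - by move=> y _; rewrite lee_fin ltW.
  - by move=> y _; rewrite adde_ge0.
  - exact: emeasurable_funD.
  - by apply: filterS r_le.
move=> /le_trans; apply; apply: leeD => //.
rewrite (_ : (s \* psi)%R = (psi \* s)%R); last first.
  by apply/funext => y; rewrite /= mulrC.
apply: le_trans (hoelder_ge1 mpsi ms _ p1 q1 pq) _; first by rewrite muT.
rewrite muleC; apply: lee_pmul; rewrite ?Lnorm_ge0//.
  (* Minkowski's inequality separates [sigma] from the constant [eps], whose norm is [eps] as [mu]
     has mass 1. *)
  apply: le_trans.
    exact: (eminkowski mu (mfine _ msigma) (measurable_cst eps) (ltW q1)).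
  apply: leeD.
    apply: le_Lnorm => // x.
    by rewrite /=; case: (sigma x) => [t| |]/=; rewrite ?leey.
  by rewrite [leLHS]Lnorm_cst// gee0_abs// lee_fin ltW.
exact: le_Lnorm_coupling pinumu mA nuA mpsi psi0 c0 psic p0.
Qed.

(* Gaussian tails and measurability of the distance to a point *)
Local Close Scope ereal_scope.

(* eta = 1 / (2 c) and K = exp (r1^2 / c) work as
   (r - r1)^2 >= r^2 / 2 - r1^2. *)
Lemma gaussian_tails_shift d (T : measurableType d) (R : realType)
    (P : probability T R) (Z : T -> R) (c r1 : R) :
  measurable_fun [set: T] Z -> (forall x, 0 <= Z x) -> 0 < c -> 0 <= r1 ->
  (forall r, r1 <= r ->
    (P [set x | (r < Z x)%R] <= (expR (- ((r - r1) ^+ 2 / c)))%:E)%E) ->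
  gaussian_tails P Z.
Proof.
move=> mZ Z0 c0 r10 tail; split => //.
exists (expR (r1 ^+ 2 / c)), ((2 * c)^-1); split.
- exact: expR_gt0.
- by rewrite invr_gt0 mulr_gt0.
move=> r r0; rewrite -expRD.
have [r1r|rr1] := leP r1 r.
  apply: le_trans (tail _ r1r) _; rewrite lee_fin ler_expR.
  rewrite -subr_ge0 [leRHS](_ : _ = (r - 2 * r1) ^+ 2 / (2 * c)).
    by rewrite divr_ge0 ?sqr_ge0// mulr_ge0// ltW.
  by field; rewrite gt_eqF.
(* Below [r1] the claimed bound is at least 1. *)
apply: (@le_trans _ _ 1%E).
  apply: probability_le1; rewrite -[X in measurable X]setTI.
  have -> : [set x | r < Z x] = Z @^-1` `]r, +oo[.
    by apply/seteqP; split => x /=; rewrite in_itv/= andbT.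
  exact: mZ.
rewrite lee_fin -[leLHS]expR0 ler_expR.
have rr : r ^+ 2 <= r1 ^+ 2 by rewrite ler_sqr ?nnegrE// ltW.
rewrite [leRHS](_ : _ = (2 * r1 ^+ 2 - r ^+ 2) / (2 * c)).
  by rewrite divr_ge0 ?mulr_ge0 ?(ltW c0)//; nra.
by field; rewrite gt_eqF.
Qed.

(** Open intervals generate the Borel sets of the line, and their preimages under [h] are open. *)
Lemma borel_measurable_comp (R : realType) (E : topologicalZmodType)
    (F : topologicalType) (f : E -> F) (h : F -> R) :
  borel_measurable f -> continuous h ->
  measurable_fun [set: borel E] (h \o f : borel E -> R).
Proof.
move=> mf /continuousP ch.
apply: (measurability _ (RGenOpens.measurableE R)) => _ [_ [a [b ->]] <-].
rewrite setTI comp_preimage; apply: mf; apply: sub_sigma_algebra; apply: ch.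
exact: interval_open.
Qed.

Lemma mdist_continuous (R : realType) (F : metricType R) (e : F) :
  continuous (fun y => mdist y e).
Proof.
move=> y; apply/cvgrPdist_lt => eps eps0; near=> z.
have : ball y eps z by near: z; exact: nbhsx_ballx.
rewrite ballEmdist /= => yz; apply: le_lt_trans yz.
have := metric_triangle y z e; have := metric_triangle z y e.
rewrite (metric_sym z y) ler_norml; lra.
Unshelve. all: by end_near. Qed.

(** * The tail bound *)

Theorem theorem3p1 (R : realType) (E : topologicalLmodType R)
    (polishE : polish R E) (mu : probability (borel E) R)
    (U : submodClosed E) (normU : E -> R) (normU_norm : norm_on U normU)
    (p C : R) (p_ge1 : 1 <= p) (C_ge0 : 0 <= C)
    (transport_entropy : forall nu : probability (borel E) R,
      (transport_cost U normU p nu mu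
         <= sqrte (C%:E * relative_entropy nu mu))%E)
    (F : metricType R) (f : E -> F)
    (mf : borel_measurable f)
    (r0 : R) (r0_ge0 : 0 <= r0) (e : F)
    (a_gt0 : (0 < mu [set x | (mdist (f x) e <= r0)%R])%E)
    (g sigma : E -> \bar R)
    (g_ge0 : forall x, (0 <= g x)%E)
    (sigma_ge0 : forall x, (0 <= sigma x)%E)
    (mg : measurable_fun [set: borel E] (g : borel E -> \bar R))
    (msigma : measurable_fun [set: borel E] (sigma : borel E -> \bar R))
    (f_growth : forall x h, h \in U ->
      ((mdist (f (x + h)) e)%:E <= g x + sigma x * (normU h)%:E)%E)
    (q : \bar R) (q_gt1 : (1 < q)%E) (pq_conj : (p%:E^-1 + q^-1 = 1)%E)
    (g_L1 : ('N[mu]_1[g] < +oo)%E)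
    (sigma_Lq : ('N[mu]_q[sigma] < +oo)%E) :
  let a := fine (mu [set x | mdist (f x) e <= r0]) in
  let r1 := r0 + 4 * fine ('N[mu]_1[g])%E
            + fine ('N[mu]_q[sigma])%E * Num.sqrt (2 * C * ln a^-1) in
  (forall r, r1 <= r ->
    (mu [set x | (r < mdist (f x) e)%R]
      <= expeR (- (((r - r1) ^+ 2)%:E / (C%:E * 'N[mu]_q[sigma] ^+ 2))))%E)
  /\ gaussian_tails mu (fun x : borel E => mdist (f x) e).
Proof.
move=> a r1.
have [normU_ge0 _ _ _] := normU_norm.
set Z := fun x : borel E => mdist (f x) e.
have mZ : measurable_fun [set: borel E] Z.
  exact: (borel_measurable_comp mf (mdist_continuous (e := e))).
pose A r := [set x : borel E | r < Z x].
have mA r : measurable (A r).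
  have -> : A r = Z @^-1` `]r, +oo[.
    by apply/seteqP; split => x /=; rewrite in_itv/= andbT.
  by rewrite -[X in measurable X]setTI; exact: mZ.
set N1 := ('N[mu]_1[g])%E in r1 g_L1 *.
set Nq := ('N[mu]_q[sigma])%E in r1 sigma_Lq *.
pose G := fine N1; pose S := fine Nq.
have N1E : N1 = G%:E by rewrite fineK// ge0_fin_numE// Lnorm_ge0.
have NqE : Nq = S%:E by rewrite fineK// ge0_fin_numE// Lnorm_ge0.
have G0 : 0 <= G by rewrite fine_ge0// Lnorm_ge0.
have S0 : 0 <= S by rewrite fine_ge0// Lnorm_ge0.
have r1_ge : G <= r1.
  rewrite /r1 -/G -/S -addrA addrCA ler_wpDr// ?addr_ge0 ?mulr_ge0 ?sqrtr_ge0//.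
  by rewrite ler_peMl// ler1n.
have bound r : (0 < mu (A r))%E ->
    r <= G + S * Num.sqrt (C * - ln (fine (mu (A r)))).
  move=> muA0; set m := fine _; set t := Num.sqrt _.
  pose nu : probability (borel E) R := mnormalize (mrestr mu (mA r)) mu.
  have nuA : nu (A r) = 1%E.
    have muAfin : mu (A r) \is a fin_num by exact: fin_num_measure.
    rewrite [LHS]mnormalize_mrestrE// setIid -{1}(fineK muAfin) -EFinM divff//.
    by rewrite gt_eqF// fine_gt0// muA0 ltey_eq muAfin.
  have cost : (transport_cost U normU p nu mu <= t%:E)%E.
    apply: le_trans (transport_entropy nu) _.
    by rewrite /nu relative_entropy_conditioning// -EFinM.
  suff eps_bound eps : 0 < eps -> r - G <= (S + eps) * t.
    rewrite -lerBlDl; apply/ler_addgt0Pr => eps eps0.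
    (* The slack [eps / (1 + t)] contributes at most [eps] after multiplication by [t], and is
       defined even when [t = 0]. *)
    have t1 : 0 < 1 + t by rewrite ltr_wpDr ?sqrtr_ge0.
    apply: le_trans (eps_bound _ (divr_gt0 eps0 t1)) _.
    rewrite mulrDl lerD2l -mulrA ler_piMr ?(ltW eps0)//.
    by rewrite ler_pdivrMl// mulr1 lerDr.
  move=> eps0; have Seps : 0 < S + eps by rewrite ltr_wpDl.
  (* After division by [S + eps] the claim is a lower bound for an infimum, to be checked on each
     coupling separately. *)
  rewrite -ler_pdivrMl// -lee_fin; apply: le_trans cost.
  apply: le_ereal_inf_tmp => _ [pi pinumu <-].
  pose c (z : borel E * borel E) := subspace_dist U normU z.1 z.2.
  have c0 z : (0 <= c z)%E.
    by rewrite /c /subspace_dist; case: ifPn => // zU; rewrite lee_fin normU_ge0.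
  (* The growth condition is applied at the base point [y] with increment [x - y], which lies in [U]
     when [c (x, y)] is finite. *)
  have rg x y : A r x -> (c (x, y) < +oo)%E ->
      (r%:E <= g y + sigma y * c (x, y))%E.
    move=> /ltW; rewrite -lee_fin => rZ; rewrite /c /subspace_dist/=.
    case: ifPn => // xyU _; apply: le_trans rZ _.
    by have := f_growth y _ xyU; rewrite addrC subrK.
  have := coupling_bound pinumu (mA r) nuA c0 g_ge0 sigma_ge0 mg msigma p_ge1
    q_gt1 pq_conj sigma_Lq rg eps0.
  rewrite -/N1 -/Nq N1E NqE -EFinD.
  have := poweR_ge0 (\int[pi]_z (c z `^ p))%E p^-1.
  case: (_ `^ _)%E => [w _| |//].
  - by rewrite -EFinM -EFinD !lee_fin -lerBlDl -ler_pdivrMl.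
  - by move=> _ _; exact: leey.
(* Free of division, this form also covers [C * S ^+ 2 = 0]. The square root squares back because
   [- ln m] is nonnegative. *)
have sqr_bound r : r1 <= r -> (0 < mu (A r))%E ->
    (r - r1) ^+ 2 <= C * S ^+ 2 * - ln (fine (mu (A r))).
  move=> r1r muA0; set m := fine _.
  have lnm : 0 <= - ln m.
    rewrite oppr_ge0 ln_le0// -lee_fin fineK ?fin_num_measure//.
    exact: probability_le1.
  rewrite mulrAC -[X in X * _](@sqr_sqrtr _ (C * - ln m)) ?mulr_ge0//.
  rewrite -exprMn ler_sqr ?nnegrE ?subr_ge0 ?mulr_ge0 ?sqrtr_ge0//.
  rewrite mulrC lerBlDl; apply: le_trans (bound _ muA0) _.
  by rewrite lerD2r.
(* The free constant [c] serves twice: as [C * S ^+ 2] when that is positive, and as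
   [C * S ^+ 2 + 1], which is always positive, for the Gaussian tails. *)
have tail r c : r1 <= r -> 0 < c -> C * S ^+ 2 <= c ->
    (mu (A r) <= (expR (- ((r - r1) ^+ 2 / c)))%:E)%E.
  move=> r1r c0 CSc; have [muA0|muA0] := ltP 0%E (mu (A r)); last first.
    by apply: le_trans muA0 _; rewrite lee_fin expR_ge0.
  have muAfin : mu (A r) \is a fin_num by exact: fin_num_measure.
  have m0 : 0 < fine (mu (A r)) by rewrite fine_gt0// muA0 ltey_eq muAfin.
  rewrite -(fineK muAfin) lee_fin -[leLHS]lnK ?posrE// ler_expR lerNr.
  rewrite ler_pdivrMr// mulrC; apply: le_trans (sqr_bound _ r1r muA0) _.
  rewrite ler_wpM2r// oppr_ge0 ln_le0// -lee_fin fineK//.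
  exact: probability_le1.
split; last first.
  apply: (@gaussian_tails_shift _ _ _ _ _ (C * S ^+ 2 + 1) r1) => //.
  - by move=> x; exact: mdist_ge0.
  - by rewrite ltr_wpDl// mulr_ge0// sqr_ge0.
  - exact: le_trans r1_ge.
  - move=> r r1r; apply: tail => //; last by rewrite lerDl.
    by rewrite ltr_wpDl// mulr_ge0// sqr_ge0.
move=> r r1r; rewrite -/(A r) NqE -EFin_expe -EFinM.
have [CS0|CS0] := eqVneq (C * S ^+ 2) 0; last first.
  rewrite inver (negbTE CS0) -EFinM -EFinN /=; apply: tail => //.
  by rewrite lt_neqAle eq_sym CS0 mulr_ge0// sqr_ge0.
(* In the degenerate case positive measure of [A r] forces [r = r1]; the exponent is then 0 times an
   inverse, which is 0, and the bound is 1. *)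
have [muA0|muA0] := ltP 0%E (mu (A r)); last first.
  by apply: le_trans muA0 _; exact: expeR_ge0.
have : (r - r1) ^+ 2 = 0.
  apply/eqP; rewrite eq_le sqr_ge0 andbT.
  by rewrite -[leRHS](mul0r (- ln (fine (mu (A r))))) -CS0 sqr_bound.
by move=> ->; rewrite mul0e oppe0 expeR0 probability_le1.
Qed.
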